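(* Let $f:\mathbb{R}^d\to\mathbb{R}$ have $L$-Lipschitz gradient with $f^\star=\inf f>-\infty$. Consider asynchronous SGD $x_{t+1}=x_t-\gamma g_t$, where $D(t)\in\{1,\dots,t\}$ are deterministic with $0\le t-D(t)\le\tau$ for all $t$, and $\mathbb{E}[g_t\mid\mathcal F_t]=f'(x_{D(t)})$, $\mathbb{E}[\|g_t-f'(x_{D(t)})\|^2\mid\mathcal F_t]\le\sigma^2$, with $\mathcal F_t=\sigma(g_1,\dots,g_{t-1})$. With learning rate $\gamma=\frac{1}{L(\tau+1)+\sqrt{TL}\,\sigma}$ for a horizon $T$, $$\frac1T\sum_{t=1}^T\mathbb{E}\|f'(x_t)\|^2\le C\left(\frac LT+\frac{\sqrt L\,\sigma}{\sqrt T}+\frac{L\tau}{T}\right),$$ where $C$ depends only on $f(x_1)-f^\star$.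
   Context: ''$L$-Lipschitz gradient'' means $\|f'(x)-f'(y)\|\le L\|x-y\|$ for all $x,y$. *)

(* Defs.v *)
From HB Require Import structures.
From mathcomp Require Import all_boot all_order all_algebra.
From mathcomp Require Import all_classical all_reals all_analysis.
Set Implicit Arguments. Unset Strict Implicit. Unset Printing Implicit Defensive.
Import Order.TTheory GRing.Theory Num.Theory.
Import numFieldNormedType.Exports.
Local Open Scope classical_set_scope.
Local Open Scope ring_scope.

Definition dotv {R : realType} {d : nat} (u v : 'rV[R]_d) : R :=
  \sum_(i < d) u 0 i * v 0 i.
Definition sqnorm {R : realType} {d : nat} (u : 'rV[R]_d) : R := dotv u u.
Definition enorm {R : realType} {d : nat} (u : 'rV[R]_d) : R := Num.sqrt (sqnorm u).

Definition is_gradient {R : realType} {d : nat}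
  (f : 'rV[R]_d -> R) (G : 'rV[R]_d -> 'rV[R]_d) : Prop :=
  forall x : 'rV[R]_d, differentiable f x /\
    forall h : 'rV[R]_d, 'd f x h = dotv (G x) h.

Definition lipschitz_grad {R : realType} {d : nat}
  (G : 'rV[R]_d -> 'rV[R]_d) (L : R) : Prop :=
  forall x y : 'rV[R]_d, enorm (G x - G y) <= L * enorm (x - y).

(* F_t = sigma(g_1, ..., g_{t-1}): the sigma-algebra (on Omega) generated by
   the coordinates of g_i, 1 <= i < t (Borel sets of R^d = product Borel). *)
Definition past_sigma {R : realType} {d : nat} {d0 : measure_display}
  {Omega : measurableType d0} (g : nat -> Omega -> 'rV[R]_d) (t : nat)
  : set (set Omega) :=
  <<s [set A | exists i (j : 'I_d) (B : set R),
          [/\ (1 <= i < t)%N, measurable B &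
              A = (fun w => g i w 0 j) @^-1` B]] >>.

(* "E[X | F] = Y" for R^d-valued X, Y, stated through the defining property
   of conditional expectation (componentwise): X and Y integrable and
   int_A X dP = int_A Y dP for every A in F. *)
Definition cond_exp_is {R : realType} {d : nat} {d0 : measure_display}
  {Omega : measurableType d0} (P : probability Omega R)
  (F : set (set Omega)) (X Y : Omega -> 'rV[R]_d) : Prop :=
  forall j : 'I_d,
    P.-integrable setT (fun w => (X w 0 j)%:E) /\
    P.-integrable setT (fun w => (Y w 0 j)%:E) /\
    forall A, F A ->
      (\int[P]_(w in A) (X w 0 j)%:E = \int[P]_(w in A) (Y w 0 j)%:E)%E.

(* "E[Z | F] <= c" a.s. for a nonnegative real Z, via the defining property:
   int_A Z dP <= c P(A) for every A in F. *)
Definition cond_exp_le {R : realType} {d0 : measure_display}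
  {Omega : measurableType d0} (P : probability Omega R)
  (F : set (set Omega)) (Z : Omega -> R) (c : R) : Prop :=
  forall A, F A -> (\int[P]_(w in A) (Z w)%:E <= c%:E * P A)%E.

(* Main.v *)
(* Write x_{t+1} = x_t - gamma (f'(x_{D t}) + xi_t) with martingale noise xi.  The descent
   lemma gives, along every path,
     2 (f(x_{t+1}) - f(x_t)) / gamma <= - |G|^2 - |H|^2 + |G - H|^2 - 2 <G, xi>
                                        + L gamma |H + xi|^2,
   where G = f'(x_t), H = f'(x_{D t}), and |G - H| <= L gamma |sum_{D t <= s < t} (H_s + xi_s)|.
   The step size leaves almost no slack for the delay, so the drift and the noise in this sum
   are separated by a Young inequality with the weight c / tau, c = 1 + 2 b, where
   b = sqrt(T L) sigma / L.  With gamma = 1 / (L (tau + 1 + b)) the |H|^2 terms then cancel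
   after summation over t, still pathwise.  Only noise terms are left to integrate: the cross
   terms vanish by orthogonality to the past, and the squares contribute at most
   2 / (gamma T) on average.  This gives C(Delta) = 2 Delta + 2. *)
Require Import Defs.
From HB Require Import structures.
From mathcomp Require Import all_boot all_order all_algebra.
From mathcomp Require Import all_classical all_reals all_analysis.
From mathcomp Require Import measurable_realfun.
From mathcomp Require Import ring lra zify.
Set Implicit Arguments. Unset Strict Implicit. Unset Printing Implicit Defensive.
Import Order.TTheory GRing.Theory Num.Theory.
Import numFieldNormedType.Exports.
Local Open Scope classical_set_scope.
Local Open Scope ring_scope.

(** * Euclidean inner product and Young inequalities on row vectors *)

Section EuclideanVectors.
Context {R : realType} {d : nat}.
Implicit Types u v w : 'rV[R]_d.

Lemma dotvC u v : dotv u v = dotv v u.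
Proof. by apply: eq_bigr => i _; rewrite mulrC. Qed.

Lemma dotvDl u v w : dotv (u + v) w = dotv u w + dotv v w.
Proof. by rewrite /dotv -big_split; apply: eq_bigr => i _; rewrite mxE mulrDl. Qed.

Lemma dotvZl k u v : dotv (k *: u) v = k * dotv u v.
Proof. by rewrite /dotv mulr_sumr; apply: eq_bigr => i _; rewrite mxE mulrA. Qed.

Lemma dotvDr u v w : dotv u (v + w) = dotv u v + dotv u w.
Proof. by rewrite dotvC dotvDl !(dotvC u). Qed.

Lemma dotvZr k u v : dotv u (k *: v) = k * dotv u v.
Proof. by rewrite dotvC dotvZl dotvC. Qed.

Lemma dotvNl u v : dotv (- u) v = - dotv u v.
Proof. by rewrite -scaleN1r dotvZl mulN1r. Qed.

Lemma dotvNr u v : dotv u (- v) = - dotv u v.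
Proof. by rewrite dotvC dotvNl dotvC. Qed.

Lemma dot0v u : dotv 0 u = 0.
Proof. by rewrite -(scale0r (0 : 'rV[R]_d)) dotvZl mul0r. Qed.

Lemma dotv_suml I (r : seq I) (F : I -> 'rV[R]_d) v :
  dotv (\sum_(i <- r) F i) v = \sum_(i <- r) dotv (F i) v.
Proof.
elim: r => [|i r IH]; first by rewrite !big_nil dot0v.
by rewrite !big_cons dotvDl IH.
Qed.

Lemma dotv_sumr I (r : seq I) (F : I -> 'rV[R]_d) v :
  dotv v (\sum_(i <- r) F i) = \sum_(i <- r) dotv v (F i).
Proof. by rewrite dotvC dotv_suml; apply: eq_bigr => i _; rewrite dotvC. Qed.

Lemma sqnorm_ge0 u : 0 <= sqnorm u.
Proof. by apply: sumr_ge0 => i _; rewrite -expr2 sqr_ge0. Qed.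

Lemma sqnorm0 : sqnorm (0 : 'rV[R]_d) = 0.
Proof. exact: dot0v. Qed.

Lemma sqnormD u v : sqnorm (u + v) = sqnorm u + 2 * dotv u v + sqnorm v.
Proof. by rewrite /sqnorm dotvDl !dotvDr (dotvC v u); ring. Qed.

Lemma sqnormZ k u : sqnorm (k *: u) = k ^+ 2 * sqnorm u.
Proof. by rewrite /sqnorm dotvZl dotvZr; ring. Qed.

Lemma sqnormN u : sqnorm (- u) = sqnorm u.
Proof. by rewrite /sqnorm dotvNl dotvNr opprK. Qed.

Lemma sqr_coord_le_sqnorm u j : u 0 j ^+ 2 <= sqnorm u.
Proof.
rewrite /sqnorm /dotv (bigD1 j) //= -expr2 lerDl.
by apply: sumr_ge0 => i _; rewrite -expr2 sqr_ge0.
Qed.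

Lemma sqnorm_sum I (r : seq I) (F : I -> 'rV[R]_d) :
  sqnorm (\sum_(i <- r) F i) =
  \sum_(i <- r) \sum_(j <- r) dotv (F i) (F j).
Proof. by rewrite /sqnorm dotv_suml; apply: eq_bigr => i _; rewrite dotv_sumr. Qed.

(** Expand |c u - v|^2 >= 0 and divide by c. The free weight c later balances drift against
    noise. *)
Lemma dotv_young (c : R) u v : 0 < c ->
  2 * dotv u v <= c * sqnorm u + c^-1 * sqnorm v.
Proof.
move=> c0; have := sqnorm_ge0 (c *: u - v).
rewrite sqnormD sqnormZ sqnormN dotvNr dotvZl => h.
rewrite -(ler_pM2l c0) mulrDr !mulrA divff ?gt_eqF// mul1r.
by nra.
Qed.

Lemma sqnormD_young (c : R) u v : 0 < c ->
  sqnorm (u + v) <= (1 + c) * sqnorm u + (1 + c^-1) * sqnorm v.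
Proof. by move=> c0; rewrite sqnormD; have := dotv_young u v c0; lra. Qed.

(** Each inner product in the expanded double sum is at most half the sum of the two squared
    norms. *)
Lemma sqnorm_sum_le I (r : seq I) (F : I -> 'rV[R]_d) :
  sqnorm (\sum_(i <- r) F i) <= (size r)%:R * \sum_(i <- r) sqnorm (F i).
Proof.
rewrite sqnorm_sum.
apply: (@le_trans _ _
  (\sum_(i <- r) \sum_(j <- r) (2^-1 * sqnorm (F i) + 2^-1 * sqnorm (F j)))).
  apply: ler_sum => i _; apply: ler_sum => j _.
  by have := dotv_young (F i) (F j) ltr01; rewrite invr1; lra.
under eq_bigr do rewrite big_split/= big_const_seq count_predT iter_addr_0.
rewrite big_split/= big_const_seq count_predT iter_addr_0.
rewrite sumrMnl -!mulr_sumr -!(mulr_natl (2^-1 * _)).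
by set S := \sum_(i <- r) _; lra.
Qed.

End EuclideanVectors.

(** * Lipschitz gradients and the descent lemma *)

Section LipschitzGradient.
Context {R : realType} {d : nat}.
Variables (f : 'rV[R]_d -> R) (f' : 'rV[R]_d -> 'rV[R]_d) (L : R).
Hypotheses (L0 : 0 < L) (lipf' : lipschitz_grad f' L).

Lemma lipschitz_grad_sqnorm x y :
  sqnorm (f' x - f' y) <= L ^+ 2 * sqnorm (x - y).
Proof.
have := lipf' x y; rewrite /enorm => h.
rewrite -(sqr_sqrtr (sqnorm_ge0 (f' x - f' y))) -(sqr_sqrtr (sqnorm_ge0 (x - y))).
by rewrite -exprMn lerXn2r ?nnegrE// ?sqrtr_ge0// mulr_ge0 ?sqrtr_ge0 ?ltW.
Qed.

(** The difference quotients of the restriction to a line are those of the directional derivative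
    along [h], which the gradient evaluates. *)
Lemma is_derive_line (gradf : is_gradient f f') (x h : 'rV[R]_d) (s : R) :
  is_derive s 1 (fun r : R => f (x + r *: h)) (dotv (f' (x + s *: h)) h).
Proof.
have [df dfE] := gradf (x + s *: h).
have E : (fun k : R => k^-1 *: (((fun r : R => f (x + r *: h)) \o shift s) (k *: 1)
             - f (x + s *: h))) =
         (fun k : R => k^-1 *: ((f \o shift (x + s *: h)) (k *: h) - f (x + s *: h))).
  apply/funext => k /=; congr (_ *: (f _ - _)).
  by rewrite -[X in X + s]/(k * 1) mulr1 scalerDl addrCA.
split.
  by rewrite /derivable E; exact: diff_derivable.
by rewrite /derive E -[LHS]/('D_h f (x + s *: h)) deriveE// dfE.
Qed.

Lemma descent (gradf : is_gradient f f') (x h : 'rV[R]_d) :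
  f (x + h) <= f x + dotv (f' x) h + L / 2 * sqnorm h.
Proof.
(* The gap between [f] on the segment and its quadratic upper model; a nonpositive derivative on (0,
   1) gives the claim. *)
pose phi (s : R) := f (x + s *: h) - (s * dotv (f' x) h + L / 2 * sqnorm h * (s * s)).
have dphi (s : R) : is_derive s 1 phi
    (dotv (f' (x + s *: h)) h - (dotv (f' x) h + L * sqnorm h * s)).
  have dl := is_derive_line gradf x h s.
  have -> : phi = (fun r : R => f (x + r *: h)) -
    (dotv (f' x) h *: @id R + (L / 2 * sqnorm h) *: (@id R * @id R)).
    by apply/funext => r; rewrite /phi /GRing.scale/= [r * _]mulrC.
  apply: (is_derive_eq (is_deriveB dl (is_deriveD (is_deriveZ _ (is_derive_id _ _))
    (is_deriveZ _ (is_deriveM (is_derive_id _ _) (is_derive_id _ _)))))).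
  rewrite /GRing.scale/=; lra.
have phi_le : phi 1 <= phi 0.
  apply: (@ler0_derive1_nincr R phi 0 1) => //.
  - move=> s; rewrite in_itv/= => /andP[s0 _].
    rewrite derive1E derive_val.
    (* The Young weight 1 / (L s) matches the Lipschitz bound L s |h| on the change of gradient:
       both Young terms are at most L s |h|^2. *)
    have Ls : 0 < (L * s)^-1 by rewrite invr_gt0 mulr_gt0.
    have := dotv_young (f' (x + s *: h) - f' x) h Ls.
    have := lipschitz_grad_sqnorm (x + s *: h) x.
    rewrite addrAC subrr add0r sqnormZ invrK dotvDl dotvNl => h1 h2.
    have : (L * s)^-1 * sqnorm (f' (x + s *: h) - f' x) <= L * s * sqnorm h.
      rewrite ler_pdivrMl ?mulr_gt0//; apply: le_trans h1 _.
      by rewrite le_eqVlt; apply/orP; left; apply/eqP; ring.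
    lra.
  - apply: derivable_within_continuous => s _.
    exact: ex_derive.
by move: phi_le; rewrite /phi scale1r scale0r addr0; lra.
Qed.

End LipschitzGradient.

(** * Pathwise descent along delayed noisy gradient steps *)

(** After exchanging the sums, a given s is counted only for t in (s, s + tau], hence at most tau
    times. *)
Lemma sum_delayed_le {R : realType} (tau T : nat) (D : nat -> nat) (h : nat -> R) :
  (forall t, (1 <= t)%N -> (1 <= D t)%N /\ (t - D t <= tau)%N) ->
  (forall s, 0 <= h s) ->
  \sum_(1 <= t < T.+1) \sum_(D t <= s < t) h s
    <= tau%:R * \sum_(1 <= s < T.+1) h s.
Proof.
move=> hD h0.
apply: (@le_trans _ _
  (\sum_(1 <= t < T.+1) \sum_(1 <= s < T.+1 | (s < t <= s + tau)%N) h s)).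
  rewrite big_nat_cond [leRHS]big_nat_cond; apply: ler_sum => t.
  rewrite andbT => /andP[t1 tT]; have [D1 Dt] := hD t t1.
  have [tD|tD] := leqP t (D t); first by rewrite big_geq// sumr_ge0.
  have [tD' tT'] := (ltnW tD, ltnW tT).
  rewrite [leRHS](big_cat_nat (n := D t))//=; last exact: leq_trans tT'.
  rewrite [X in _ + X](big_cat_nat (n := t))//=.
  rewrite -[leLHS]add0r addrA -[leLHS]addr0.
  rewrite lerD// ?sumr_ge0// lerD// ?sumr_ge0//.
  rewrite big_nat_cond [leRHS]big_nat_cond le_eqVlt; apply/orP; left.
  by apply/eqP/eq_bigl => s; lia.
rewrite (exchange_big_dep predT)//=.
rewrite mulr_sumr; apply: ler_sum => s _.
rewrite big_const_seq iter_addr_0 -[leLHS]mulr_natl ler_wpM2r// ler_nat.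
rewrite -size_filter -[leqRHS](size_iota s.+1 tau).
apply: uniq_leq_size; first by rewrite filter_uniq ?iota_uniq.
move=> t; rewrite mem_filter => /andP[/andP[st ts] _].
by rewrite mem_iota st addSn ltnS.
Qed.

Section DelayedDescent.
Context {R : realType} {d : nat}.
Variables (f : 'rV[R]_d -> R) (f' : 'rV[R]_d -> 'rV[R]_d) (L gamma c m : R).
Variables (tau : nat) (D : nat -> nat) (x xi : nat -> 'rV[R]_d).
Hypotheses (L0 : 0 < L) (lipf' : lipschitz_grad f' L).
Hypothesis (gradf : is_gradient f f').
Hypothesis (m_le : forall y, m <= f y).
Hypotheses (gamma0 : 0 < gamma) (c0 : 0 < c).
Hypothesis hD : forall t, (1 <= t)%N -> (1 <= D t <= t)%N /\ (t - D t <= tau)%N.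
Hypothesis step : forall t, (1 <= t)%N ->
  x t.+1 = x t - gamma *: (f' (x (D t)) + xi t).

Let H t := f' (x (D t)).

Lemma iterate_sum a b : (1 <= a <= b)%N ->
  x b - x a = - gamma *: \sum_(a <= s < b) (H s + xi s).
Proof.
move=> /andP[a1 /subnK <-]; elim: (b - a)%N => [|k IH].
  by rewrite big_geq// subrr scaler0.
rewrite addSn big_nat_recr ?leq_addl//= step; last lia.
by rewrite [in RHS]scalerDr -IH addrAC scaleNr.
Qed.

(** Young with weight c / tau separates drift from noise; the drift is a sum of at most tau vectors,
    which costs a factor tau, and (1 + c / tau) tau = tau + c. *)
Lemma delayed_sum_le t : (1 <= t)%N ->
  sqnorm (\sum_(D t <= s < t) (H s + xi s))
  <= (tau%:R + c) * \sum_(D t <= s < t) sqnorm (H s)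
     + (1 + tau%:R / c) * sqnorm (\sum_(D t <= s < t) xi s).
Proof.
move=> t1; have [/andP[D1 Dt] tD] := hD t1.
(* The weight c / tau requires tau > 0; for tau = 0 the window is empty. *)
have [tau0|tau0] := posnP tau.
  have -> : D t = t by lia.
  by rewrite !big_geq// sqnorm0 !mulr0 addr0.
have taup : 0 < tau%:R :> R by rewrite ltr0n.
rewrite big_split/=.
have := @sqnormD_young R d (c / tau%:R) (\sum_(D t <= s < t) H s)
  (\sum_(D t <= s < t) xi s) (divr_gt0 c0 taup).
move=> /le_trans; apply; rewrite invf_div lerD2r.
have -> : tau%:R + c = (1 + c / tau%:R) * tau%:R by field; rewrite gt_eqF.
have ct0 := divr_gt0 c0 taup.
rewrite -mulrA ler_wpM2l ?addr_ge0 ?(ltW ct0)//.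
apply: (le_trans (sqnorm_sum_le _ _)).
rewrite size_iota ler_wpM2r ?ler_nat//.
by apply: sumr_ge0 => s _; exact: sqnorm_ge0.
Qed.

(** Scale the descent lemma by 2 / gamma, use -2 <G, H> = |G - H|^2 - |G|^2 - |H|^2, and control |G
    - H| by the delayed sum. The last parenthesis gathers every term containing noise. *)
Lemma delayed_step_le t : (1 <= t)%N ->
  sqnorm (f' (x t)) <= 2 / gamma * (f (x t) - f (x t.+1))
    - (1 - L * gamma) * sqnorm (H t)
    + L ^+ 2 * gamma ^+ 2 * (tau%:R + c) * \sum_(D t <= s < t) sqnorm (H s)
    + (L ^+ 2 * gamma ^+ 2 * (1 + tau%:R / c) * sqnorm (\sum_(D t <= s < t) xi s)
       + 2 * L * gamma * dotv (H t) (xi t) - 2 * dotv (f' (x t)) (xi t)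
       + L * gamma * sqnorm (xi t)).
Proof.
move=> t1; have [/andP[D1 Dt] tD] := hD t1.
have h1 := descent L0 lipf' gradf (x t) (- gamma *: (H t + xi t)).
rewrite scaleNr -step// -scaleNr dotvZr sqnormZ dotvDr in h1.
rewrite sqnormD in h1.
have h2 := lipschitz_grad_sqnorm L0 lipf' (x t) (x (D t)).
rewrite iterate_sum ?D1// sqnormZ sqrrN sqnormD sqnormN dotvNr -/(H t) in h2.
have h3 := delayed_sum_le t1.
have h4 := ler_wpM2l (mulr_ge0 (sqr_ge0 L) (sqr_ge0 gamma)) h3.
have h5 : 2 / gamma * (f (x t.+1) - f (x t)) <= - 2 * (dotv (f' (x t)) (H t)
    + dotv (f' (x t)) (xi t)) + L * gamma *
    (sqnorm (H t) + 2 * dotv (H t) (xi t) + sqnorm (xi t)).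
  have -> : - 2 * (dotv (f' (x t)) (H t) + dotv (f' (x t)) (xi t)) +
      L * gamma * (sqnorm (H t) + 2 * dotv (H t) (xi t) + sqnorm (xi t)) =
    2 / gamma * (- gamma * (dotv (f' (x t)) (H t) + dotv (f' (x t)) (xi t))
      + L / 2 * ((- gamma) ^+ 2 *
          (sqnorm (H t) + 2 * dotv (H t) (xi t) + sqnorm (xi t)))).
    by field; rewrite gt_eqF.
  by rewrite ler_pM2l ?divr_gt0//; lra.
by lra.
Qed.

(** Summation telescopes the function values and charges each squared norm of [H s] at most tau
    times; the condition on [gamma] says that the total coefficient of these norms is
    nonpositive. *)
Lemma delayed_descent T : (1 <= T)%N ->
  L ^+ 2 * gamma ^+ 2 * (tau%:R + c) * tau%:R + L * gamma <= 1 ->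
  \sum_(1 <= t < T.+1) sqnorm (f' (x t)) <= 2 / gamma * (f (x 1%N) - m)
    + \sum_(1 <= t < T.+1)
      (L ^+ 2 * gamma ^+ 2 * (1 + tau%:R / c) * sqnorm (\sum_(D t <= s < t) xi s)
       + 2 * L * gamma * dotv (H t) (xi t) - 2 * dotv (f' (x t)) (xi t)
       + L * gamma * sqnorm (xi t)).
Proof.
move=> T1 coef.
pose SH := \sum_(1 <= t < T.+1) sqnorm (H t).
have SH0 : 0 <= SH by apply: sumr_ge0 => t _; exact: sqnorm_ge0.
have tele : \sum_(1 <= t < T.+1) (f (x t) - f (x t.+1)) <= f (x 1%N) - m.
  rewrite -[leLHS]opprK -sumrN (eq_bigr (fun t => f (x t.+1) - f (x t))).
    by rewrite telescope_sumr// opprB lerD2l lerN2.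
  by move=> t _; rewrite opprB.
have delay : \sum_(1 <= t < T.+1) \sum_(D t <= s < t) sqnorm (H s)
    <= tau%:R * SH.
  apply: sum_delayed_le => [t /hD[/andP[]]//|s]; exact: sqnorm_ge0.
have k0 : 0 <= L ^+ 2 * gamma ^+ 2 * (tau%:R + c).
  by apply: mulr_ge0; [rewrite mulr_ge0 ?sqr_ge0|rewrite addr_ge0 ?(ltW c0)].
apply: (@le_trans _ _ (\sum_(1 <= t < T.+1) (2 / gamma * (f (x t) - f (x t.+1))
    - (1 - L * gamma) * sqnorm (H t)
    + L ^+ 2 * gamma ^+ 2 * (tau%:R + c) * \sum_(D t <= s < t) sqnorm (H s)
    + (L ^+ 2 * gamma ^+ 2 * (1 + tau%:R / c) * sqnorm (\sum_(D t <= s < t) xi s)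
       + 2 * L * gamma * dotv (H t) (xi t) - 2 * dotv (f' (x t)) (xi t)
       + L * gamma * sqnorm (xi t))))).
  rewrite big_nat_cond [leRHS]big_nat_cond; apply: ler_sum => t.
  by rewrite andbT => /andP[t1 _]; exact: delayed_step_le.
rewrite big_split/= lerD2r !big_split/= sumrN -!mulr_sumr -/SH.
have h1 := ler_wpM2l (ltW (divr_gt0 (ltr0Sn R 1) gamma0)) tele.
have h2 := ler_wpM2l k0 delay.
have h3 := ler_wpM2r SH0 coef.
lra.
Qed.

End DelayedDescent.

(** * Measurability of Lipschitz functions of random vectors *)

Section LipschitzMeasurable.
Context {R : realType} {d : nat}.

Lemma rational_vector_dense (y : 'rV[R]_d) (e : R) : 0 < e ->
  exists q : 'rV[rat]_d, sqnorm (y - map_mx ratr q) < e.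
Proof.
(* From eta <= 1 follows eta^2 <= eta, so each coordinate costs at most e / (d + 1); the d + 1 keeps
   the total strictly below e. *)
move=> e0; pose eta := Num.min 1 (e / d.+1%:R).
have eta0 : 0 < eta by rewrite lt_min ltr01 divr_gt0.
have /choice[q hq] (j : 'I_d) : exists q : rat, ratr q \in `]y 0 j - eta, y 0 j + eta[%R.
  by apply: rat_in_itvoo; rewrite ltrBlDr -addrA ltrDl addr_gt0.
exists (\row_j q j).
apply: (@le_lt_trans _ _ (\sum_(j < d) e / d.+1%:R)).
  apply: ler_sum => j _; rewrite !mxE -expr2.
  have := hq j; rewrite in_itv/= => /andP[h1 h2].
  have eta1 : eta <= 1 by rewrite ge_min lexx.
  have eta2 : eta <= e / d.+1%:R by rewrite ge_min lexx orbT.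
  apply: le_trans eta2; nra.
rewrite sumr_const card_ord -[ltLHS]mulr_natr -mulrA gtr_pMr//.
by rewrite mulrC ltr_pdivrMr// mul1r ltr_nat.
Qed.

(** The domain is an arbitrary measurable type, so that the result serves both the full space and
    the sigma-algebra of the past. *)
Lemma measurable_lipschitz_comp (dT : measure_display) (T : measurableType dT)
    (phi : 'rV[R]_d -> R) (K : R) (X : T -> 'rV[R]_d) : 0 < K ->
  (forall y z, (phi y - phi z) ^+ 2 <= K * sqnorm (y - z)) ->
  (forall j, measurable_fun setT (fun w => X w 0 j)) ->
  measurable_fun setT (fun w => phi (X w)).
Proof.
move=> K0 lip mX.
apply: (measurability _ (RGenOInfty.measurableE R)) => _ [_ [a ->] <-].
rewrite setTI.
(* Since phi is Lipschitz, phi (X w) > a is certified by a nearby rational q. *)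
have -> : (fun w => phi (X w)) @^-1` `]a, +oo[ =
   \bigcup_(q : 'rV[rat]_d) [set w | (a < phi (map_mx ratr q)) /\
      K * sqnorm (X w - map_mx ratr q) < (phi (map_mx ratr q) - a) ^+ 2].
  apply/seteqP; split=> w /=; rewrite in_itv/= andbT.
    move=> aw.
    (* This radius keeps phi q within half the gap phi (X w) - a of phi (X w), so phi q - a exceeds
       the other half. *)
    have e0 : 0 < ((phi (X w) - a) / 2) ^+ 2 / K.
      by rewrite divr_gt0// exprn_gt0// divr_gt0// subr_gt0.
    have [q hq] := rational_vector_dense (X w) e0.
    exists q => //=.
    have := lip (X w) (map_mx ratr q).
    move: hq; rewrite ltr_pdivlMr// mulrC => hq h.
    have h' := le_lt_trans h hq.
    have h3 : (phi (X w) - a) / 2 < phi (map_mx ratr q) - a by nra.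
    split; first by lra.
    apply: lt_le_trans hq _; nra.
  move=> [q _ /= [aq hq]].
  have h := le_lt_trans (lip (X w) (map_mx ratr q)) hq.
  nra.
apply: countable_bigcupT_measurable => [|q]; first exact: countableP.
have [aq|qa] := ltP a (phi (map_mx ratr q)); last first.
  rewrite [X in measurable X](_ : _ = set0)//.
  by apply/seteqP; split => // w /= [].
rewrite [X in measurable X](_ : _ = setT `&`
  (fun w => K * sqnorm (X w - map_mx ratr q)) @^-1`
    `]-oo, (phi (map_mx ratr q) - a) ^+ 2[); last first.
  by apply/seteqP; split => w /=; rewrite in_itv/=; [move=> [] | move=> []].
have : measurable_fun setT (fun w => K * sqnorm (X w - map_mx ratr q)).
  apply: measurable_funM => //.
  apply: measurable_sum => j.
  apply: measurable_funM; under eq_fun do rewrite !mxE;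
    by apply: measurable_funB.
by apply => //; exact: measurable_itv.
Qed.

End LipschitzMeasurable.

(** * Orthogonality of a conditionally centred variable to functions measurable for the
    sub-sigma-algebra *)

Section MeanZero.
Import HBNNSimple.
Context {R : realType} {d0 : measure_display} {Omega : measurableType d0}.
Variables (P : probability Omega R) (G : set (set Omega)).
Hypothesis subG : <<s G >> `<=` measurable.

Lemma sub_measurable_fun (Z : Omega -> R) :
  measurable_fun (setT : set (g_sigma_algebraType G)) Z ->
  measurable_fun (setT : set Omega) Z.
Proof. by move=> mZ _ B mB; apply: subG; exact: mZ. Qed.

Variable xi : Omega -> R.
Hypothesis ixi : P.-integrable setT (EFin \o xi).
Hypothesis xi0 : forall A, <<s G >> A -> (\int[P]_(w in A) (xi w)%:E = 0)%E.

(** The level sets of [h] are finitely many and lie in the sub-sigma-algebra, where [xi] integrates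
    to zero. *)
Lemma integral_simple_mul_mean_zero (h : {nnsfun (g_sigma_algebraType G) >-> R}) :
  (\int[P]_w (h w * xi w)%:E = 0)%E.
Proof.
have mh y : <<s G >> (h @^-1` [set y]).
  have := @measurable_sfunP _ _ _ _ h [set y].
  by apply.
under eq_integral => w _.
  rewrite (fimfunE h w) fsbig_finite//= mulr_suml -sumEFin.
  rewrite (eq_bigr (fun y => y%:E * ((EFin \o xi) \_ (h @^-1` [set y])) w)%E); last first.
    move=> y _; rewrite -mulrA EFinM; congr (_ * _)%E.
    rewrite patchE indicE; case: ifP => _; rewrite ?mul1r ?mul0r//.
  over.
have ip y : P.-integrable setT ((EFin \o xi) \_ (h @^-1` [set y])).
  have mA := subG (mh y).
  by apply/(integrable_mkcond _ mA); apply: integrableS ixi.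
rewrite integral_sum//; last by move=> y; apply: integrableZl.
rewrite big1// => y _; rewrite integralZl//.
by rewrite -integral_mkcond xi0// mule0.
Qed.

(** Approximate [Z] from below by simple functions and pass to the limit by dominated convergence,
    with dominating function |Z xi|. *)
Lemma integral_nonneg_mul_mean_zero (Z : Omega -> R) :
  measurable_fun (setT : set (g_sigma_algebraType G)) Z ->
  (forall w, 0 <= Z w) ->
  P.-integrable setT (fun w => (Z w * xi w)%:E) ->
  (\int[P]_w (Z w * xi w)%:E = 0)%E.
Proof.
move=> mZ Z0 iZ.
have mZE : measurable_fun (setT : set (g_sigma_algebraType G)) (EFin \o Z).
  exact/measurable_EFinP.
pose h := nnsfun_approx measurableT mZE.
have mxi : measurable_fun setT xi by apply/measurable_EFinP; case/integrableP: ixi.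
have hcvg w : (EFin \o h^~ w) n @[n --> \oo] --> (Z w)%:E.
  by apply: (cvg_nnsfun_approx measurableT mZE) => // t _; rewrite lee_fin.
have hle n w : h n w <= Z w.
  rewrite -lee_fin; have := @le_approx _ _ _ setT (EFin \o Z) n w.
  by rewrite /h nnsfun_approxE; apply => // t _; rewrite lee_fin.
have mhxi n : measurable_fun (setT : set Omega) (fun w : Omega => h n w * xi w).
  apply: measurable_funM; last exact: mxi.
  apply: (@sub_measurable_fun (fun w => h n w)).
  exact: measurable_funPT.
have [|||||_ _ ] := @dominated_convergence _ _ _ P setT measurableT
  (fun n w => (h n w * xi w)%:E) (fun w => (Z w * xi w)%:E)
  (fun w => `|(Z w * xi w)%:E|)%E.
- by move=> n; apply/measurable_EFinP.
- by case/integrableP: iZ.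
- apply: aeW => w _.
  under eq_fun do rewrite EFinM; rewrite EFinM.
  by apply: cvgeZr => //; exact: hcvg.
- exact: integrable_abse.
- apply: aeW => w n _; rewrite lee_fin !normrM ler_wpM2r//.
  by rewrite !ger0_norm// ?hle.
- under eq_fun do rewrite integral_simple_mul_mean_zero.
  by move/cvg_lim => <- //; rewrite lim_cst.
Qed.

(** Split [Z] into positive and negative parts; both are at most |Z|, so their products with [xi]
    stay integrable. *)
Lemma integral_mul_mean_zero (Z : Omega -> R) :
  measurable_fun (setT : set (g_sigma_algebraType G)) Z ->
  P.-integrable setT (fun w => (Z w * xi w)%:E) ->
  (\int[P]_w (Z w * xi w)%:E = 0)%E.
Proof.
move=> mZ iZ.
have mxi : measurable_fun setT xi by apply/measurable_EFinP; case/integrableP: ixi.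
have pos (W : Omega -> R) : measurable_fun (setT : set (g_sigma_algebraType G)) W ->
    (forall w, 0 <= W w <= `|Z w|) ->
    P.-integrable setT (fun w => (W w * xi w)%:E).
  move=> mW W0; apply: (le_integrable _ _ _ iZ) => //.
    by apply/measurable_EFinP/measurable_funM => //; exact: sub_measurable_fun.
  move=> w _; rewrite lee_fin !normrM ler_wpM2r//.
  by have /andP[w0 wZ] := W0 w; rewrite ger0_norm.
have mp : measurable_fun (setT : set (g_sigma_algebraType G)) Z^\+.
  exact: measurable_funrpos.
have mn : measurable_fun (setT : set (g_sigma_algebraType G)) Z^\-.
  exact: measurable_funrneg.
have bp w : 0 <= Z^\+ w <= `|Z w|.
  by rewrite funrpos_ge0 /funrpos/=; case: (leP (Z w) 0) => z0; rewrite ?normr_ge0 ?ler_norm.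
have bn w : 0 <= Z^\- w <= `|Z w|.
  rewrite funrneg_ge0 /funrneg/=; case: (leP (- Z w) 0) => z0; rewrite ?normr_ge0//.
  by rewrite -normrN ler_norm.
have ip := pos _ mp bp; have inn := pos _ mn bn.
have -> : (fun w => (Z w * xi w)%:E) =
    (fun w => (Z^\+ w * xi w)%:E - (Z^\- w * xi w)%:E)%E.
  by apply/funext => w; rewrite -EFinB -mulrBl -[in LHS](funrposBneg Z).
by rewrite integralB// !integral_nonneg_mul_mean_zero ?sube0.
Qed.

End MeanZero.

(** * Integrability and expectation of real random variables *)

Section Expectation.
Context {R : realType} {d0 : measure_display} {Omega : measurableType d0}.
Variable P : probability Omega R.
Implicit Types X Y : Omega -> R.

Lemma Rintegrable_cst (k : R) : P.-integrable setT (EFin \o (fun=> k)).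
Proof. exact: finite_measure_integrable_cst. Qed.

Lemma RintegrableD X Y : P.-integrable setT (EFin \o X) ->
  P.-integrable setT (EFin \o Y) -> P.-integrable setT (EFin \o (fun w => X w + Y w)).
Proof. by move=> iX iY; exact: (integrableD measurableT iX iY). Qed.

Lemma RintegrableZ (k : R) X : P.-integrable setT (EFin \o X) ->
  P.-integrable setT (EFin \o (fun w => k * X w)).
Proof. by move=> iX; exact: (integrableZl measurableT k iX). Qed.

Lemma RintegrableB X Y : P.-integrable setT (EFin \o X) ->
  P.-integrable setT (EFin \o Y) -> P.-integrable setT (EFin \o (fun w => X w - Y w)).
Proof. by move=> iX iY; exact: (integrableB measurableT iX iY). Qed.

Lemma Rintegrable_sum (I : eqType) (r : seq I) (F : I -> Omega -> R) :
  (forall i, i \in r -> P.-integrable setT (EFin \o F i)) ->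
  P.-integrable setT (EFin \o (fun w => \sum_(i <- r) F i w)).
Proof.
elim: r => [_|i r IH h].
  by under eq_fun do rewrite big_nil; exact: Rintegrable_cst.
under eq_fun do rewrite big_cons; apply: RintegrableD.
  by apply: h; rewrite mem_head.
by apply: IH => j jr; apply: h; rewrite inE jr orbT.
Qed.

Lemma Rintegral_sum (I : eqType) (r : seq I) (F : I -> Omega -> R) :
  (forall i, i \in r -> P.-integrable setT (EFin \o F i)) ->
  \int[P]_w (\sum_(i <- r) F i w) = \sum_(i <- r) \int[P]_w F i w.
Proof.
elim: r => [_|i r IH h].
  under eq_Rintegral do rewrite big_nil.
  by rewrite Rintegral_cst// mul0r big_nil.
have ir j : j \in r -> P.-integrable setT (EFin \o F j).
  by move=> jr; apply: h; rewrite inE jr orbT.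
under eq_Rintegral do rewrite big_cons.
rewrite big_cons RintegralD ?IH//; first by apply: h; rewrite mem_head.
exact: Rintegrable_sum.
Qed.

Lemma Rintegral_prob_cst (k : R) : \int[P]_(w in setT) k = k.
Proof. by rewrite Rintegral_cst//= (@probability_setT _ _ _ P) mulr1. Qed.

End Expectation.

(** * Square-integrable random vectors *)

Section SquareIntegrable.
Context {R : realType} {d0 : measure_display} {Omega : measurableType d0}.
Context {d : nat}.
Variable P : probability Omega R.
Implicit Types X Y : Omega -> 'rV[R]_d.

(** The space L^2 of random vectors, described by coordinates so that only real-valued measurability
    enters. *)
Definition square_integrable X : Prop := forall j,
  measurable_fun setT (fun w => X w 0 j) /\
  P.-integrable setT (EFin \o (fun w => X w 0 j ^+ 2)).

Lemma measurable_sqnorm (X : Omega -> 'rV[R]_d) :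
  (forall j, measurable_fun setT (fun w => X w 0 j)) ->
  measurable_fun setT (fun w => sqnorm (X w)).
Proof. by move=> mX; apply: measurable_sum => j; apply: measurable_funM. Qed.

Lemma square_integrable_le X (h : Omega -> R) :
  (forall j, measurable_fun setT (fun w => X w 0 j)) ->
  P.-integrable setT (EFin \o h) -> (forall w, sqnorm (X w) <= h w) ->
  square_integrable X.
Proof.
move=> mX ih hX j; split => //.
apply: (le_integrable _ _ _ ih) => //.
  by apply/measurable_EFinP/measurable_funX.
move=> w _; rewrite /= lee_fin ger0_norm ?sqr_ge0//.
apply: le_trans (ler_norm _); apply: le_trans (hX w).
exact: sqr_coord_le_sqnorm.
Qed.

Lemma integrable_coordM X Y j : square_integrable X -> square_integrable Y ->
  P.-integrable setT (EFin \o (fun w => X w 0 j * Y w 0 j)).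
Proof.
move=> /(_ j)[mX iX] /(_ j)[mY iY].
apply: (le_integrable _ _ _ (RintegrableD iX iY)) => //.
  by apply/measurable_EFinP/measurable_funM.
move=> w _; rewrite /= lee_fin normrM [leRHS]ger0_norm ?addr_ge0 ?sqr_ge0//.
rewrite -(real_normK (num_real (X w 0 j))) -(real_normK (num_real (Y w 0 j))).
by have := normr_ge0 (X w 0 j); have := normr_ge0 (Y w 0 j); nra.
Qed.

Lemma integrable_dotv X Y : square_integrable X -> square_integrable Y ->
  P.-integrable setT (EFin \o (fun w => dotv (X w) (Y w))).
Proof. by move=> sX sY; apply: Rintegrable_sum => j _; exact: integrable_coordM. Qed.

Lemma integrable_sqnorm X : square_integrable X ->
  P.-integrable setT (EFin \o (fun w => sqnorm (X w))).
Proof. by move=> sX; exact: integrable_dotv. Qed.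

Lemma square_integrable_cst v : square_integrable (fun=> v).
Proof. by move=> j; split => //; exact: Rintegrable_cst. Qed.

Lemma square_integrableD X Y : square_integrable X -> square_integrable Y ->
  square_integrable (fun w => X w + Y w).
Proof.
move=> sX sY.
apply: (@square_integrable_le _ (fun w => 2 * sqnorm (X w) + 2 * sqnorm (Y w))).
- move=> j; under eq_fun do rewrite mxE.
  by apply: measurable_funD; [case: (sX j)|case: (sY j)].
- by apply: RintegrableD; apply: RintegrableZ; exact: integrable_sqnorm.
- move=> w; have := sqnormD_young (X w) (Y w) ltr01.
  by rewrite invr1 -[1 + 1]/(2 : R).
Qed.

Lemma square_integrableZ k X : square_integrable X ->
  square_integrable (fun w => k *: X w).
Proof.
move=> sX.
apply: (@square_integrable_le _ (fun w => k ^+ 2 * sqnorm (X w))).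
- move=> j; under eq_fun do rewrite mxE.
  by apply: measurable_funM => //; case: (sX j).
- by apply: RintegrableZ; exact: integrable_sqnorm.
- by move=> w; rewrite sqnormZ.
Qed.

Lemma square_integrableB X Y : square_integrable X -> square_integrable Y ->
  square_integrable (fun w => X w - Y w).
Proof.
move=> sX sY; under eq_fun do rewrite -scaleN1r.
by apply: square_integrableD => //; exact: square_integrableZ.
Qed.

Lemma square_integrable_of_bound X (b : R) :
  (forall j, measurable_fun setT (fun w => X w 0 j)) ->
  (\int[P]_w (sqnorm (X w))%:E <= b%:E)%E -> square_integrable X.
Proof.
move=> mX hb; apply: (@square_integrable_le _ (fun w => sqnorm (X w))) => //.
apply/integrableP; split; first exact/measurable_EFinP/measurable_sqnorm.
under eq_integral do rewrite gee0_abs ?lee_fin ?sqnorm_ge0//.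
exact: le_lt_trans hb (ltry _).
Qed.

Lemma measurable_lipschitz_grad (dT : measure_display) (T : measurableType dT)
    (F : 'rV[R]_d -> 'rV[R]_d) (L : R) (X : T -> 'rV[R]_d) (j : 'I_d) :
  0 < L -> lipschitz_grad F L ->
  (forall j, measurable_fun setT (fun w => X w 0 j)) ->
  measurable_fun setT (fun w => F (X w) 0 j).
Proof.
move=> L0 lipF mX.
apply: (@measurable_lipschitz_comp _ _ _ _ (fun y => F y 0 j) (L ^+ 2)) => //.
  by rewrite exprn_gt0.
move=> y z; apply: le_trans (lipschitz_grad_sqnorm L0 lipF y z).
by apply: le_trans (sqr_coord_le_sqnorm _ j); rewrite !mxE.
Qed.

(** Write F X = (F X - F 0) + F 0: the first summand has norm at most L |X|, the second is
    constant. *)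
Lemma square_integrable_lipschitz (F : 'rV[R]_d -> 'rV[R]_d) (L : R) X :
  0 < L -> lipschitz_grad F L -> square_integrable X ->
  square_integrable (fun w => F (X w)).
Proof.
move=> L0 lipF sX.
have h : square_integrable (fun w => F (X w) - F 0).
  apply: (@square_integrable_le _ (fun w => L ^+ 2 * sqnorm (X w))).
  - move=> j; under eq_fun do rewrite !mxE; apply: measurable_funB => //.
    by apply: (measurable_lipschitz_grad _ L0 lipF) => i; case: (sX i).
  - by apply: RintegrableZ; exact: integrable_sqnorm.
  - by move=> w; have := lipschitz_grad_sqnorm L0 lipF (X w) 0; rewrite subr0.
have := square_integrableD h (square_integrable_cst (F 0)).
by under eq_fun do rewrite subrK.
Qed.

End SquareIntegrable.

(** * The SGD process: adaptedness, second moments and uncorrelated noise *)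

Section AsyncSGD.
Context {R : realType} {d : nat} {d0 : measure_display} {Omega : measurableType d0}.
Variables (f' : 'rV[R]_d -> 'rV[R]_d) (L sigma gamma : R) (tau : nat).
Variables (D : nat -> nat) (P : probability Omega R).
Variables (g x : nat -> Omega -> 'rV[R]_d) (x1 : 'rV[R]_d).
Hypotheses (L0 : 0 < L) (lipf' : lipschitz_grad f' L).
Hypothesis hD : forall t, (1 <= t)%N -> (1 <= D t <= t)%N /\ (t - D t <= tau)%N.
Hypothesis x_init : forall w, x 1%N w = x1.
Hypothesis x_step : forall t w, (1 <= t)%N -> x t.+1 w = x t w - gamma *: g t w.
Hypothesis g_mean : forall t, (1 <= t)%N ->
  cond_exp_is P (past_sigma g t) (g t) (fun w => f' (x (D t) w)).
Hypothesis g_var : forall t, (1 <= t)%N ->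
  cond_exp_le P (past_sigma g t)
    (fun w => sqnorm (g t w - f' (x (D t) w))) (sigma ^+ 2).

(** The generators of [past_sigma g t], isolated so that [g_sigma_algebraType] can be formed from
    them. *)
Definition past_events (t : nat) : set (set Omega) :=
  [set A | exists i (j : 'I_d) (B : set R),
     [/\ (1 <= i < t)%N, measurable B & A = (fun w => g i w 0 j) @^-1` B]].

Definition noise (t : nat) (w : Omega) : 'rV[R]_d := g t w - f' (x (D t) w).

Lemma grad_noise t w : f' (x (D t) w) + noise t w = g t w.
Proof. by rewrite /noise addrC subrK. Qed.

Definition adapted (t : nat) (X : Omega -> 'rV[R]_d) : Prop := forall j,
  measurable_fun (setT : set (g_sigma_algebraType (past_events t)))
    (fun w => X w 0 j).

Lemma measurable_g t j : (1 <= t)%N -> measurable_fun setT (fun w => g t w 0 j).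
Proof.
by move=> t1; have [/integrableP[/measurable_EFinP ? _] _] := g_mean t1 j.
Qed.

Lemma past_sigma_measurable t : <<s past_events t >> `<=` measurable.
Proof.
apply: smallest_sub; first exact: sigma_algebra_measurable.
move=> _ [i [j [B [/andP[i1 _] mB ->]]]].
by rewrite -[X in measurable X]setTI; exact: measurable_g.
Qed.

Lemma adapted_g s t : (1 <= s < t)%N -> adapted t (g s).
Proof.
move=> st j _ B mB; rewrite setTI; apply: sub_sigma_algebra.
by exists s, j, B.
Qed.

(** [x s] is built from the gradients before time s, so s = t is allowed here, whereas [adapted_g]
    stops at s < t. *)
Lemma adapted_x s t : (1 <= s <= t)%N -> adapted t (x s).
Proof.
elim: s => // -[_ _|s IH st] j.
  by rewrite (_ : (fun w => _) = cst (x1 0 j))//; apply/funext => w; rewrite x_init.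
under eq_fun do rewrite x_step// !mxE.
apply: measurable_funB; first by apply: IH; lia.
by apply: measurable_funM => //; apply: adapted_g; lia.
Qed.

Lemma adapted_grad s t : (1 <= s <= t)%N -> adapted t (fun w => f' (x s w)).
Proof.
by move=> st j; apply: (measurable_lipschitz_grad _ L0 lipf'); exact: adapted_x.
Qed.

Lemma adapted_noise s t : (1 <= s < t)%N -> adapted t (noise s).
Proof.
move=> st j; rewrite /noise; under eq_fun do rewrite !mxE.
apply: measurable_funB; first exact: adapted_g.
have /hD[] : (1 <= s)%N by lia.
by move=> ? ?; apply: adapted_grad; lia.
Qed.

Lemma noise_second_moment t : (1 <= t)%N ->
  (\int[P]_w (sqnorm (noise t w))%:E <= (sigma ^+ 2)%:E)%E.
Proof.
move=> t1.
have := g_var t1 (@measurableT _ (g_sigma_algebraType (past_events t))).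
by rewrite probability_setT mule1.
Qed.

Lemma square_integrable_noise_of t : (1 <= t)%N ->
  square_integrable P (x (D t)) -> square_integrable P (noise t).
Proof.
move=> t1 sx; apply: square_integrable_of_bound (noise_second_moment t1) => j.
rewrite /noise; under eq_fun do rewrite !mxE.
apply: measurable_funB; first exact: measurable_g.
by apply: (measurable_lipschitz_grad _ L0 lipf') => i; case: (sx i).
Qed.

(** Strong induction, since the step from t to t + 1 uses the possibly much earlier [x (D t)], whose
    square-integrability gives that of the noise at time t. *)
Lemma square_integrable_x t : (1 <= t)%N -> square_integrable P (x t).
Proof.
elim/ltn_ind: t => -[//|[|t]] IH _.
  rewrite (_ : x 1%N = fun=> x1); first exact: square_integrable_cst.
  exact/funext.
have [/andP[D1 Dt] _] := hD (ltn0Sn t).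
have sD : square_integrable P (x (D t.+1)) by apply: IH.
have sn := square_integrable_noise_of (ltn0Sn t) sD.
rewrite (_ : x t.+2 = fun w => x t.+1 w - gamma *: (f' (x (D t.+1) w) + noise t.+1 w)).
  apply: square_integrableB; first exact: IH.
  apply/square_integrableZ/square_integrableD => //.
  exact: (square_integrable_lipschitz L0 lipf' sD).
by apply/funext => w; rewrite x_step// grad_noise.
Qed.

Lemma square_integrable_grad t : (1 <= t)%N ->
  square_integrable P (fun w => f' (x t w)).
Proof.
by move=> t1; apply: (square_integrable_lipschitz L0 lipf'); exact: square_integrable_x.
Qed.

Lemma D_ge1 t : (1 <= t)%N -> (1 <= D t)%N.
Proof. by move=> /hD[/andP[]]. Qed.

Lemma square_integrable_noise t : (1 <= t)%N -> square_integrable P (noise t).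
Proof.
move=> t1; apply: square_integrable_noise_of => //.
exact/square_integrable_x/D_ge1.
Qed.

(** Over every past event [g t] and the delayed gradient have equal integrals, so the noise
    integrates to zero there; [integral_mul_mean_zero] extends this from events to adapted [Z]. *)
Lemma noise_orthogonal t (Z : Omega -> 'rV[R]_d) : (1 <= t)%N ->
  adapted t Z -> square_integrable P Z ->
  \int[P]_w dotv (Z w) (noise t w) = 0.
Proof.
move=> t1 aZ sZ; have sn := square_integrable_noise t1.
have imul j := integrable_coordM j sZ sn.
rewrite /dotv Rintegral_sum// big1// => j _.
rewrite /Rintegral (@integral_mul_mean_zero _ _ _ P (past_events t)
  _ (fun w => noise t w 0 j) _ _ (fun w => Z w 0 j))//.
- exact: past_sigma_measurable.
- have [ig [ih _]] := g_mean t1 j.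
  rewrite /noise; under eq_fun do rewrite !mxE; exact: RintegrableB.
- move=> A FA; have [ig [ih /(_ A FA) gh]] := g_mean t1 j.
  rewrite /noise; under eq_integral do rewrite !mxE EFinB.
  have mA := past_sigma_measurable FA.
  rewrite integralB//=; [|exact: integrableS ig|exact: integrableS ih].
  rewrite gh subee//; apply: integrable_fin_num => //; exact: integrableS ih.
- exact: imul.
Qed.

Lemma expected_sqnorm_noise t : (1 <= t)%N ->
  \int[P]_w sqnorm (noise t w) <= sigma ^+ 2.
Proof.
move=> t1; rewrite -lee_fin /Rintegral fineK; first exact: noise_second_moment.
exact/integrable_fin_num/integrable_sqnorm/square_integrable_noise.
Qed.

Lemma expected_dotv_noise s t : (1 <= s)%N -> (1 <= t)%N -> s != t ->
  \int[P]_w dotv (noise s w) (noise t w) = 0.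
Proof.
(* By symmetry the first factor may be the earlier noise, which is adapted at the later time. *)
wlog st : s t / (s < t)%N.
  move=> hw s1 t1 st; have [lt|lt] : (s < t \/ t < s)%N by lia.
    exact: hw.
  under eq_Rintegral do rewrite dotvC.
  by apply: hw => //; rewrite eq_sym.
move=> s1 t1 _; apply: noise_orthogonal => //.
  by apply: adapted_noise; rewrite s1.
exact: square_integrable_noise.
Qed.

Lemma integrable_sqnorm_sum_noise (r : seq nat) :
  (forall s, s \in r -> (1 <= s)%N) ->
  P.-integrable setT (EFin \o (fun w => sqnorm (\sum_(s <- r) noise s w))).
Proof.
move=> r1; under eq_fun do rewrite sqnorm_sum.
apply: Rintegrable_sum => s /r1 s1; apply: Rintegrable_sum => t /r1 t1.
by apply: integrable_dotv; exact: square_integrable_noise.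
Qed.

(** Orthogonality removes the off-diagonal terms of the expanded square, so the bound is linear in
    the number of terms; [uniq r] makes each diagonal term occur once. *)
Lemma expected_sqnorm_sum_noise (r : seq nat) : uniq r ->
  (forall s, s \in r -> (1 <= s)%N) ->
  \int[P]_w sqnorm (\sum_(s <- r) noise s w) <= (size r)%:R * sigma ^+ 2.
Proof.
move=> ur r1.
have idot s t : s \in r -> t \in r ->
    P.-integrable setT (EFin \o (fun w => dotv (noise s w) (noise t w))).
  move=> /r1 s1 /r1 t1.
  by apply: integrable_dotv; exact: square_integrable_noise.
under eq_Rintegral do rewrite sqnorm_sum.
rewrite Rintegral_sum; last first.
  by move=> s sr; apply: Rintegrable_sum => t tr; exact: idot.
apply: (@le_trans _ _ (\sum_(s <- r) sigma ^+ 2)); last first.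
  by rewrite big_const_seq count_predT iter_addr_0 mulr_natl.
rewrite big_seq [leRHS]big_seq; apply: ler_sum => s sr.
rewrite Rintegral_sum => [|t tr]; last exact: idot.
rewrite (bigD1_seq s)//= big_seq_cond big1 => [|t /andP[tr ts]].
  by rewrite addr0; apply: expected_sqnorm_noise; exact: r1.
by apply: expected_dotv_noise; rewrite ?r1// eq_sym.
Qed.

(** * The bound for any step size meeting the cancellation condition *)

Section Convergence.
Variables (f : 'rV[R]_d -> R) (c m : R) (T : nat).
Hypothesis (gradf : is_gradient f f').
Hypothesis (m_le : forall y, m <= f y).
Hypotheses (gamma0 : 0 < gamma) (c0 : 0 < c) (T1 : (1 <= T)%N).
Hypothesis coef :
  L ^+ 2 * gamma ^+ 2 * (tau%:R + c) * tau%:R + L * gamma <= 1.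

Let a := L ^+ 2 * gamma ^+ 2 * (1 + tau%:R / c).

Lemma sum_expected_sqnorm_grad :
  \sum_(1 <= t < T.+1) \int[P]_w sqnorm (f' (x t w))
  <= 2 / gamma * (f x1 - m)
     + T%:R * (a * (tau%:R * sigma ^+ 2) + L * gamma * sigma ^+ 2).
Proof.
have ge1 t : t \in index_iota 1 T.+1 -> (1 <= t)%N.
  by rewrite mem_index_iota => /andP[].
have a0 : 0 <= a.
  apply: mulr_ge0; first by rewrite mulr_ge0 ?sqr_ge0.
  by rewrite addr_ge0// divr_ge0// ltW.
pose S t w := a * sqnorm (\sum_(D t <= s < t) noise s w)
  + 2 * L * gamma * dotv (f' (x (D t) w)) (noise t w)
  - 2 * dotv (f' (x t w)) (noise t w) + L * gamma * sqnorm (noise t w).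
have sumge1 t : (1 <= t)%N -> forall s, s \in index_iota (D t) t -> (1 <= s)%N.
  move=> t1 s; rewrite mem_index_iota => /andP[Ds _].
  exact: leq_trans (D_ge1 t1) Ds.
have i1 t : (1 <= t)%N ->
    P.-integrable setT (EFin \o (fun w => a * sqnorm (\sum_(D t <= s < t) noise s w))).
  by move=> t1; apply/RintegrableZ/integrable_sqnorm_sum_noise/sumge1.
have i2 t : (1 <= t)%N ->
    P.-integrable setT (EFin \o (fun w => 2 * L * gamma * dotv (f' (x (D t) w)) (noise t w))).
  move=> t1; apply/RintegrableZ/integrable_dotv; last exact: square_integrable_noise.
  exact/square_integrable_grad/D_ge1.
have i3 t : (1 <= t)%N ->
    P.-integrable setT (EFin \o (fun w => 2 * dotv (f' (x t w)) (noise t w))).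
  move=> t1; apply/RintegrableZ/integrable_dotv; last exact: square_integrable_noise.
  exact/square_integrable_grad.
have i4 t : (1 <= t)%N ->
    P.-integrable setT (EFin \o (fun w => L * gamma * sqnorm (noise t w))).
  by move=> t1; apply/RintegrableZ/integrable_sqnorm/square_integrable_noise.
have i12 t (t1 : (1 <= t)%N) := RintegrableD (i1 t t1) (i2 t t1).
have i123 t (t1 : (1 <= t)%N) := RintegrableB (i12 t t1) (i3 t t1).
have iS t (t1 : (1 <= t)%N) := RintegrableD (i123 t t1) (i4 t t1).
have ES t : (1 <= t)%N ->
    \int[P]_w S t w <= a * (tau%:R * sigma ^+ 2) + L * gamma * sigma ^+ 2.
  move=> t1; have [/andP[D1 Dt] tD] := hD t1.
  rewrite (RintegralD measurableT (i123 t t1) (i4 t t1)).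
  rewrite (RintegralB measurableT (i12 t t1) (i3 t t1)).
  rewrite (RintegralD measurableT (i1 t t1) (i2 t t1)).
  have sn := square_integrable_noise t1.
  have sG := square_integrable_grad t1.
  have sH := square_integrable_grad D1.
  rewrite (RintegralZl _ measurableT (integrable_sqnorm_sum_noise (sumge1 _ t1))).
  rewrite (RintegralZl _ measurableT (integrable_dotv sH sn)).
  rewrite (RintegralZl _ measurableT (integrable_dotv sG sn)).
  rewrite (RintegralZl _ measurableT (integrable_sqnorm sn)).
  (* Since D t <= t, both gradients depend only on the past of t, so both cross terms vanish in
     expectation. *)
  have aG : adapted t (fun w => f' (x t w)) by apply: adapted_grad; rewrite t1/=.
  have aH : adapted t (fun w => f' (x (D t) w)) by apply: adapted_grad; rewrite D1.
  rewrite (noise_orthogonal t1 aG sG) (noise_orthogonal t1 aH sH).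
  rewrite !mulr0 addr0 subr0 lerD//.
    rewrite ler_wpM2l//.
    (* The window from D t to t - 1 has t - D t <= tau indices. *)
    apply: (le_trans (expected_sqnorm_sum_noise (iota_uniq _ _) (sumge1 _ t1))).
    by rewrite size_iota ler_wpM2r ?sqr_ge0// ler_nat.
  by rewrite ler_wpM2l ?mulr_ge0 ?(ltW L0) ?(ltW gamma0)// expected_sqnorm_noise.
rewrite -Rintegral_sum; last first.
  by move=> t /ge1 t1; exact/integrable_sqnorm/square_integrable_grad.
have iSS : P.-integrable setT (EFin \o (fun w => \sum_(1 <= t < T.+1) S t w)).
  by apply: Rintegrable_sum => t /ge1; exact: iS.
(* Integrate the pathwise bound, applied separately at each [w]. *)
apply: (@le_trans _ _ (\int[P]_w (2 / gamma * (f x1 - m) + \sum_(1 <= t < T.+1) S t w))).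
  apply: le_Rintegral => //.
  - by apply: Rintegrable_sum => t /ge1 t1; exact/integrable_sqnorm/square_integrable_grad.
  - by apply: RintegrableD => //; exact: Rintegrable_cst.
  - move=> w _; rewrite -(x_init w).
    apply: (@delayed_descent R d f f' L gamma c m tau D (x^~ w) (noise^~ w)) => //.
    by move=> t t1; rewrite x_step// grad_noise.
rewrite RintegralD//; last exact: Rintegrable_cst.
rewrite Rintegral_prob_cst lerD2l Rintegral_sum => [|t /ge1]; last exact: iS.
apply: (@le_trans _ _ (\sum_(1 <= t < T.+1)
   (a * (tau%:R * sigma ^+ 2) + L * gamma * sigma ^+ 2))).
  by rewrite big_seq [leRHS]big_seq; apply: ler_sum => t /ge1; exact: ES.
by rewrite big_const_seq count_predT size_iota subSS subn0 iter_addr_0 [leRHS]mulr_natl.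
Qed.

End Convergence.

End AsyncSGD.

(** * Arithmetic of the step size, with s = 1 / (L gamma) and c = 2 b + 1 *)

Section StepSize.
Context {R : realType}.
Implicit Types tau b s : R.

(** After multiplication by s^2 the terms containing tau match exactly, which explains c = 2 b + 1;
    the slack is b^2 + b. *)
Lemma stepsize_coef tau b s : 0 <= tau -> 0 <= b -> s = tau + 1 + b ->
  s^-1 ^+ 2 * (tau + (2 * b + 1)) * tau + s^-1 <= 1.
Proof.
move=> tau0 b0 sE; have s0 : 0 < s by lra.
rewrite -(ler_pM2l (exprn_gt0 2 s0)).
have -> : s ^+ 2 * (s^-1 ^+ 2 * (tau + (2 * b + 1)) * tau + s^-1) =
   (tau + (2 * b + 1)) * tau + s by field; rewrite gt_eqF.
by have := mulr_ge0 b0 b0; rewrite sE; nra.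
Qed.

(** The delayed noise contribution in units of L, as T sigma^2 = L b^2. The growth of c with b
    reduces tau^2 b^2 / c to at most tau^2 b; then tau b <= s^2 and tau + b <= s conclude. *)
Lemma stepsize_noise tau b s : 0 <= tau -> 0 <= b -> s = tau + 1 + b ->
  s^-1 ^+ 2 * (1 + tau / (2 * b + 1)) * tau * b ^+ 2 <= s.
Proof.
move=> tau0 b0 sE; have s0 : 0 < s by lra.
have c0 : 0 < 2 * b + 1 by lra.
rewrite -(ler_pM2l (exprn_gt0 2 s0)).
have -> : s ^+ 2 * (s^-1 ^+ 2 * (1 + tau / (2 * b + 1)) * tau * b ^+ 2) =
   tau * b ^+ 2 + tau ^+ 2 * b * (b / (2 * b + 1)).
  by field; rewrite !gt_eqF.
have hb : b / (2 * b + 1) <= 1 by rewrite ler_pdivrMr//; lra.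
have h1 : tau ^+ 2 * b * (b / (2 * b + 1)) <= tau ^+ 2 * b.
  by rewrite ler_piMr// mulr_ge0// sqr_ge0.
have tb : 0 <= tau * b by exact: mulr_ge0.
apply: (@le_trans _ _ (tau * b * (tau + b))); first by lra.
have h2 : tau * b <= s ^+ 2.
  by have := sqr_ge0 tau; have := sqr_ge0 b; rewrite sE; nra.
have h3 : tau + b <= s by lra.
by apply: ler_pM => //; lra.
Qed.

Lemma stepsize_variance tau b s : 0 <= tau -> 0 <= b -> s = tau + 1 + b ->
  s^-1 * b ^+ 2 <= s.
Proof.
move=> tau0 b0 sE; have s0 : 0 < s by lra.
rewrite ler_pdivrMl// -expr2 lerXn2r// ?nnegrE//; lra.
Qed.

End StepSize.

(** * The stated rate from the prescribed step size *)

Theorem theorem4 :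
  forall R : realType, exists C : R -> R,
  forall (d : nat) (f : 'rV[R]_d -> R) (f' : 'rV[R]_d -> 'rV[R]_d) (L sigma : R)
    (tau T : nat) (D : nat -> nat)
    (d0 : measure_display) (Omega : measurableType d0) (P : probability Omega R)
    (g : nat -> Omega -> 'rV[R]_d) (x : nat -> Omega -> 'rV[R]_d)
    (x1 : 'rV[R]_d),
    is_gradient f f' ->
    0 < L -> lipschitz_grad f' L ->
    has_lbound (range f) ->
    0 <= sigma ->
    (forall t, (1 <= t)%N -> (1 <= D t <= t)%N /\ (t - D t <= tau)%N) ->
    (1 <= T)%N ->
    let gamma := (L * (tau.+1)%:R + Num.sqrt (T%:R * L) * sigma)^-1 in
    (forall w, x 1%N w = x1) ->
    (forall t w, (1 <= t)%N -> x t.+1 w = x t w - gamma *: g t w) ->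
    (forall t, (1 <= t)%N ->
       cond_exp_is P (past_sigma g t) (g t) (fun w => f' (x (D t) w))) ->
    (forall t, (1 <= t)%N ->
       cond_exp_le P (past_sigma g t)
         (fun w => sqnorm (g t w - f' (x (D t) w))) (sigma ^+ 2)) ->
    ((T%:R)^-1%:E * \sum_(1 <= t < T.+1) \int[P]_w (sqnorm (f' (x t w)))%:E
      <= (C (f x1 - inf (range f)) *
           (L / T%:R + Num.sqrt L * sigma / Num.sqrt T%:R
            + L * tau%:R / T%:R))%:E)%E.
Proof.
(* The initial gap contributes 2 Delta; the delayed noise and the single noise squares contribute 1
   each. *)
move=> R; exists (fun Delta => 2 * Delta + 2).
move=> d f f' L sigma tau T D d0 Omega P g x x1 gradf L0 lipf' lbf sigma0 hD T1 gamma
  x_init x_step g_mean g_var.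
have T0 : 0 < T%:R :> R by rewrite ltr0n.
have sT0 : 0 < Num.sqrt T%:R :> R by rewrite sqrtr_gt0.
pose b := Num.sqrt (T%:R * L) * sigma / L.
pose s := tau%:R + 1 + b.
have b0 : 0 <= b by rewrite divr_ge0 ?(ltW L0)// mulr_ge0// sqrtr_ge0.
have s0 : 0 < s by rewrite ltr_wpDr// ltr_wpDl.
have gammaE : gamma = (L * s)^-1.
  rewrite /gamma /s /b -natr1; congr (_^-1); field; exact: lt0r_neq0.
have Lgamma : L * gamma = s^-1.
  by rewrite gammaE; field; rewrite !lt0r_neq0.
have gamma0 : 0 < gamma by rewrite gammaE invr_gt0 mulr_gt0.
have sigmaE : sigma ^+ 2 = b ^+ 2 * L / T%:R.
  rewrite /b !exprMn sqr_sqrtr; last by rewrite mulr_ge0// ltW.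
  by field; rewrite !lt0r_neq0.
(* The bracket of the rate equals 1 / (gamma T). Writing T as the square of its root makes the
   identity rational. *)
have bracketE : L / T%:R + Num.sqrt L * sigma / Num.sqrt T%:R + L * tau%:R / T%:R
    = s * L / T%:R.
  rewrite /s /b sqrtrM ?ler0n// -[X in _ = _ / X](sqr_sqrtr (ltW T0)).
  rewrite -[in L / _](sqr_sqrtr (ltW T0)) -[in L * _ / _](sqr_sqrtr (ltW T0)).
  by field; rewrite !lt0r_neq0.
have tau0 : 0 <= tau%:R :> R by [].
have c0 : 0 < 2 * b + 1 by lra.
have m_le y : inf (range f) <= f y by apply: ge_inf => //; exists y.
have coef : L ^+ 2 * gamma ^+ 2 * (tau%:R + (2 * b + 1)) * tau%:R + L * gamma <= 1.
  by rewrite -exprMn Lgamma; exact: (stepsize_coef _ _ (erefl s)).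
have main := sum_expected_sqnorm_grad L0 lipf' hD x_init x_step g_mean g_var gradf
  m_le gamma0 c0 T1 coef.
(* Each integral is finite by square-integrability, so the extended sum is a real one. *)
rewrite (_ : (\sum_(1 <= t < T.+1) _)%E =
    (\sum_(1 <= t < T.+1) \int[P]_w sqnorm (f' (x t w)))%:E); last first.
  rewrite -sumEFin; apply: eq_big_nat => t /andP[t1 _].
  rewrite /Rintegral fineK//.
  apply/integrable_fin_num => //; apply: integrable_sqnorm.
  exact: (square_integrable_grad L0 lipf' hD x_init x_step g_mean g_var).
rewrite -EFinM lee_fin bracketE ler_pdivrMl//; apply: (le_trans main).
rewrite -exprMn Lgamma sigmaE.
have -> : 2 / gamma = 2 * (s * L) by rewrite gammaE invrK mulrC [L * s]mulrC mulrC.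
have n1 := stepsize_noise tau0 b0 (erefl s).
have n2 := stepsize_variance tau0 b0 (erefl s).
have -> : T%:R * ((2 * (f x1 - inf (range f)) + 2) * (s * L / T%:R)) =
    2 * (s * L) * (f x1 - inf (range f)) + (s + s) * L.
  by field; exact: lt0r_neq0.
rewrite lerD2l.
have -> : T%:R * (s^-1 ^+ 2 * (1 + tau%:R / (2 * b + 1)) * (tau%:R * (b ^+ 2 * L / T%:R))
     + s^-1 * (b ^+ 2 * L / T%:R)) =
   (s^-1 ^+ 2 * (1 + tau%:R / (2 * b + 1)) * tau%:R * b ^+ 2 + s^-1 * b ^+ 2) * L.
  by field; rewrite !lt0r_neq0.
by rewrite ler_pM2r// lerD.
Qed.
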